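(* Let $k$ be a field of characteristic $0$, and let $(E,H,(\cdot|\cdot))$ and $(E,H',(\cdot|\cdot)')$ be two extended affine Lie algebra structures on the same Lie algebra $E$ over $k$, with cores $E_c$ and $E'_c$ respectively. Then $E_c=E'_c$.
   Context: An extended affine Lie algebra (EALA) over $k$ is a triple $(E,H,(\cdot|\cdot))$ consisting of a Lie algebra $E$ over $k$ (possibly infinite-dimensional), a subalgebra $H\subset E$ and a nondegenerate symmetric bilinear form $(\cdot|\cdot)$ on $E$ which is invariant, i.e. $([a,b]|c)=(a|[b,c])$, such that the following hold. (EA1) $H$ is a nonzero finite-dimensional toral and self-centralizing subalgebra: $E=\bigoplus_{\alpha\in H^*}E_\alpha$ with $E_\alpha=\{e\in E:[h,e]=\alpha(h)e \text{ for all } h\in H\}$, and $E_0=H$. Put $\Psi=\{\alpha\in H^*:E_\alpha\ne 0\}$ (so $0\in\Psi$). The restriction of $(\cdot|\cdot)$ to $H\times H$ is nondegenerate and is transferred to $H^*$ by $(\alpha|\beta)=(t_\alpha|t_\beta)$, where $t_\alpha\in H$ is defined by $(t_\alpha|h)=\alpha(h)$ for all $h\in H$. Put $\Psi^{\rm an}=\{\alpha\in\Psi:(\alpha|\alpha)\neq0\}$ and $\Psi^0=\{\alpha\in\Psi:(\alpha|\alpha)=0\}$. The core $E_c$ is the subalgebra of $E$ generated by $\bigcup_{\alpha\in\Psi^{\rm an}}E_\alpha$ (it is in fact an ideal of $E$). (EA2) For every $\alpha\in\Psi^{\rm an}$ and $x_\alpha\in E_\alpha$ the operator $\operatorname{ad}x_\alpha$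 is locally nilpotent on $E$. (EA3) For any decomposition $\Psi^{\rm an}=\Psi_1\cup\Psi_2$ with $\Psi_1,\Psi_2$ nonempty one has $(\Psi_1|\Psi_2)\neq0$. (EA4) The centralizer of $E_c$ in $E$ is contained in $E_c$. (EA5) The subgroup $\Lambda=\operatorname{span}_{\mathbb Z}(\Psi^0)$ of $(H^*,+)$ is a free abelian group of finite rank. The core $E'_c$ of $(E,H',(\cdot|\cdot)')$ is defined in the same way, using $H'$ and $(\cdot|\cdot)'$. *)

(* Defs.v *)
From HB Require Import structures.
From mathcomp Require Import all_boot all_order all_algebra.
From mathcomp Require Import all_classical.

Set Implicit Arguments.
Unset Strict Implicit.
Unset Printing Implicit Defensive.

Import GRing.Theory.
Local Open Scope ring_scope.
Local Open Scope classical_set_scope.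

Reserved Notation "[ 'lie' x , y ]" (format "[ 'lie'  x ,  y ]").

(* The dimension of a lieAlgType is not assumed to be finite. *)
HB.mixin Record Lmodule_isLieAlgebra (k : fieldType) E of GRing.Lmodule k E := {
  lie_bracket : {bilinear E -> E -> E};
  lie_bracketxx : forall x : E, lie_bracket x x = 0;
  lie_jacobi : forall x y z : E,
    lie_bracket x (lie_bracket y z) + lie_bracket y (lie_bracket z x)
      + lie_bracket z (lie_bracket x y) = 0
}.

#[short(type="lieAlgType")]
HB.structure Definition LieAlgebra (k : fieldType) :=
  { E of GRing.Lmodule k E & Lmodule_isLieAlgebra k E }.

Notation "[ 'lie' x , y ]" := (lie_bracket x y) : ring_scope.

Section Submodule.
Variables (k : fieldType) (V : lmodType k).

Definition submodule (W : submodClosed V) : Type := {x : V | x \in W}.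

Variable W : submodClosed V.

HB.instance Definition _ := Choice.on (submodule W).
HB.instance Definition _ := SubType.on (submodule W).
HB.instance Definition _ := [SubChoice_isSubLmodule of submodule W by <:].

Definition finite_dimensional : Prop :=
  exists (n : nat) (b : 'I_n -> V),
    (forall i, b i \in W) /\
    (forall x, x \in W -> exists c : 'I_n -> k, x = \sum_i c i *: b i).

End Submodule.

(* The algebraic dual, as the submodule of linear maps in the k-space of all
   functions V -> k. *)
Section Dual.
Variables (k : fieldType) (V : lmodType k).

Definition scalar_pred : {pred V -> k^o} := fun a => `[< scalar a >].

Lemma scalar_pred_submod : submod_closed scalar_pred.
Proof.
split=> [|c f g /asboolP fl /asboolP gl]; apply/asboolP => a u v /=.
  by rewrite /GRing.zero /= mulr0 addr0.
have E w : (c *: f + g) w = c * f w + g w by [].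
by rewrite !E fl gl !mulrDr addrACA !mulrA [c * a]mulrC.
Qed.

HB.instance Definition _ :=
  GRing.isSubmodClosed.Build k (V -> k^o) scalar_pred scalar_pred_submod.

Definition dual : Type := {a : V -> k^o | a \in scalar_pred}.

HB.instance Definition _ := Choice.on dual.
HB.instance Definition _ := SubType.on dual.
HB.instance Definition _ := [SubChoice_isSubLmodule of dual by <:].

Definition dual_fun (a : dual) : V -> k := val a.
Coercion dual_fun : dual >-> Funclass.

End Dual.

Section AbelianGroups.
Variable V : zmodType.

Definition subgroup (M : set V) : Prop :=
  M 0 /\ (forall x y, M x -> M y -> M (x - y)).

Definition Zspan (S : set V) : set V := smallest subgroup S.

Definition free_abelian_of_finite_rank (M : set V) : Prop :=
  exists (n : nat) (b : 'I_n -> V),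
    M = [set \sum_i b i *~ m i | m in [set: 'I_n -> int]] /\
    (forall m : 'I_n -> int, \sum_i b i *~ m i = 0 -> forall i, m i = 0).

End AbelianGroups.

Section LieNotions.
Variables (k : fieldType) (E : lieAlgType k).

Definition lie_subalgebra (A : set E) : Prop :=
  [/\ A 0,
      forall (c : k) x y, A x -> A y -> A (c *: x + y)
    & forall x y, A x -> A y -> A [lie x, y]].

Definition generated_subalgebra (S : set E) : set E :=
  smallest lie_subalgebra S.

Definition centralizer (A : set E) : set E :=
  [set e | forall a, A a -> [lie e, a] = 0].

Definition locally_nilpotent (u : E -> E) : Prop :=
  forall e, exists n : nat, iter n u e = 0.

(* E is the internal direct sum of the subspaces X i; the index type may be
   infinite, the sums are finite. *)
Definition is_direct_sum (I : eqType) (X : I -> set E) : Prop :=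
  (forall e : E, exists (s : seq I) (v : I -> E),
     [/\ uniq s, forall i, X i (v i) & e = \sum_(i <- s) v i]) /\
  (forall (s : seq I) (v : I -> E), uniq s -> (forall i, X i (v i)) ->
     \sum_(i <- s) v i = 0 -> forall i, i \in s -> v i = 0).

Definition symmetric_form (f : {biscalar E}) : Prop :=
  forall x y, f x y = f y x.

Definition nondegenerate_form (f : {biscalar E}) : Prop :=
  forall x, (forall y, f x y = 0) -> x = 0.

Definition invariant_form (f : {biscalar E}) : Prop :=
  forall a b c, f [lie a, b] c = f a [lie b, c].

End LieNotions.

Section EALA.
Variables (k : fieldType) (E : lieAlgType k).
Variables (H : submodClosed E) (f : {biscalar E}).

Local Notation Hdual := (dual (submodule H)).

Definition root_space (a : Hdual) : set E :=
  [set e | forall h : submodule H, [lie val h, e] = a h *: e].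

(* 0 counts as a root. *)
Definition roots : set Hdual := [set a | exists2 e, root_space a e & e != 0].

(* t_a; for an EALA it exists (dual_vecP below) and is unique
   (form_nondegenerate_on_torus), so the default value 0 is never used. *)
Definition dual_vec (a : Hdual) : submodule H :=
  xget 0 [set t : submodule H |
    forall h : submodule H, f (val t) (val h) = a h].

Definition dual_form (a b : Hdual) : k := f (val (dual_vec a)) (val (dual_vec b)).

Definition anisotropic_roots : set Hdual :=
  [set a | roots a /\ dual_form a a <> 0].

Definition isotropic_roots : set Hdual :=
  [set a | roots a /\ dual_form a a = 0].

Definition core : set E :=
  generated_subalgebra (\bigcup_(a in anisotropic_roots) root_space a).

Definition EA1 : Prop :=
  [/\ exists2 h, h \in H & h != 0,
      finite_dimensional H,
      lie_subalgebra [set` H],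
      is_direct_sum root_space
    & root_space 0 = [set` H]].

Definition EA2 : Prop :=
  forall (a : Hdual) (x : E), anisotropic_roots a -> root_space a x ->
    locally_nilpotent (fun e => [lie x, e]).

Definition EA3 : Prop :=
  forall P1 P2 : set Hdual, anisotropic_roots = P1 `|` P2 ->
    P1 !=set0 -> P2 !=set0 ->
    exists a b, [/\ P1 a, P2 b & dual_form a b <> 0].

Definition EA4 : Prop := centralizer core `<=` core.

Definition EA5 : Prop := free_abelian_of_finite_rank (Zspan isotropic_roots).

Definition is_EALA : Prop :=
  [/\ symmetric_form f, nondegenerate_form f & invariant_form f] /\
  [/\ EA1, EA2, EA3, EA4 & EA5].

Lemma dual_scalar (a : Hdual) : scalar a.
Proof. by apply/asboolP; exact: (valP a). Qed.

Lemma form_nondegenerate_on_torus :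
  nondegenerate_form f -> invariant_form f -> EA1 ->
  forall h : submodule H,
    (forall h' : submodule H, f (val h) (val h') = 0) -> h = 0.
Proof.
move=> ndf invf [_ _ _ [dec _] E0] h fh0; apply: val_inj; apply: ndf => e.
have [s [v [_ vP ->]]] := dec e; rewrite linear_sumr big1 // => a1 _.
set a : Hdual := a1.
have [ah'|a0] := pselect (exists h' : submodule H, a h' != 0); last first.
  have : root_space 0 (v a).
    move=> h'; rewrite vP; congr (_ *: _); apply/eqP.
    by apply: contra_notT a0 => ?; exists h'.
  by rewrite E0 => vaH; exact: (fh0 (Sub (v a) vaH)).
case: ah' => h' ah'.
have h'0 : [lie val h, val h'] = 0.
  have : root_space 0 (val h') by rewrite E0; exact: (valP h').
  by move=> ->; exact: scale0r.
apply/eqP; rewrite -(mulrI_eq0 _ (mulfI ah')) -linearZr_LR -vP -invf h'0.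
by rewrite linear0l.
Qed.

Lemma dual_vecP :
  nondegenerate_form f -> invariant_form f -> symmetric_form f -> EA1 ->
  forall (a : Hdual) (h : submodule H), f (val (dual_vec a)) (val h) = a h.
Proof.
move=> ndf invf symf ea1 a; rewrite /dual_vec; case: xgetP => [t _ //|nt].
have [_ [n [b0 [b0H spanH]]] _ _ _] := ea1.
pose b i : submodule H := Sub (b0 i) (b0H i).
have valb i : val (b i) = b0 i by [].
have aZ c x y : a (c *: x + y) = c * a x + a y by exact: dual_scalar.
have a0 : a 0 = 0 by have := aZ (-1) 0 0; rewrite scaler0 addr0 mulN1r addNr.
have a_sum (c : 'I_n -> k) : a (\sum_i c i *: b i) = \sum_i c i * a (b i).
  apply: (big_ind2 (fun x y => a x = y)) => //.
    by move=> x1 x2 y1 y2 <- <-; have := aZ 1 x1 y1; rewrite scale1r mul1r.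
  by move=> i _; have := aZ (c i) (b i) 0; rewrite a0 !addr0.
have val_sum (c : 'I_n -> k) :
    val (\sum_i c i *: b i) = \sum_i c i *: b0 i.
  by rewrite raddf_sum; apply: eq_bigr => i _; exact: linearZ.
have span (h : submodule H) : exists c : 'I_n -> k, h = \sum_i c i *: b i.
  by have [c hc] := spanH _ (valP h); exists c; apply: val_inj; rewrite val_sum.
pose G : 'M[k]_n := \matrix_(i, j) f (b0 i) (b0 j).
pose r : 'rV[k]_n := \row_j a (b j).
have /submxP[x rx] : (r <= G)%MS.
  rewrite submxE; apply/eqP/rowP => j; rewrite [RHS]mxE mxE.
  pose u i := cokermx G i j.
  have y0 : \sum_i u i *: b i = 0.
    apply: (form_nondegenerate_on_torus ndf invf ea1) => h.
    have [c ->] := span h; rewrite symf !val_sum linear_sumlz big1 // => i _.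
    have Gu l : f (b0 i) (u l *: b0 l) = G i l * u l.
      by rewrite linearZr_LR /= mxE mulrC.
    rewrite /= linearZl_LR /= linear_sumr (eq_bigr _ (fun l _ => Gu l)).
    have := mulmx_coker G => /matrixP /(_ i j); rewrite !mxE => GC0.
    by apply/eqP; rewrite mulf_eq0; apply/orP; right; apply/eqP.
  rewrite -[RHS]a0 -[in RHS]y0 a_sum; apply: eq_bigr => i _.
  by rewrite mxE mulrC.
exfalso; apply: (nt (\sum_i x 0 i *: b i)) => h.
have [c ->] := span h; rewrite a_sum !val_sum linear_sumr.
apply: eq_bigr => j _; rewrite linearZr_LR /=; congr (_ * _).
have := rx => /matrixP /(_ 0 j); rewrite !mxE => ->.
rewrite linear_sumlz; apply: eq_bigr => i _.
by rewrite /= linearZl_LR /= mxE.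
Qed.

End EALA.

(* Main.v *)
Require Import Defs.
From HB Require Import structures.
From mathcomp Require Import all_boot all_order all_algebra.
From mathcomp Require Import all_classical.
From mathcomp Require Import ring zify.

(** The core of an extended affine Lie algebra is the least of the
    non-abelian ideals of E, and this pins it down without reference to the
    torus or the form.

    Let I be an ideal.  Being stable under the torus, I is graded by the roots
    (lie_ideal_graded).  If I contains a nonzero x in E_a, pairing x with some y
    in E_{-a} gives [x, y] = (x|y) t_a, so t_a lies in I; and t_a acts on E_b by
    the scalar (a|b), so I contains every E_b with (a|b) nonzero.  When a is
    anisotropic, the connectedness axiom EA3 propagates this from a to all
    anisotropic roots, and I contains the core (core_sub_ideal).  When I meets
    no anisotropic root space, a nonzero component of I in E_b forces b to be
    isotropic and orthogonal to each anisotropic a; then a + b has the nonzero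
    square (a|a), so [E_a, I_b], which lies in I and in E_{a+b}, vanishes.  Hence
    I centralizes the core (ideal_sub_centralizer), so by tameness, EA4, it lies
    in the core, and is abelian.

    Applied to I = E'_c this gives the inclusion of E_c in E'_c, and the converse
    follows by symmetry, once two things are known about a core.

    - It is not abelian: anisotropic roots exist, since otherwise the core would
      be 0 with centralizer E; and for anisotropic a the element t_a acts
      nontrivially on E_a (core_nonabelian).

    - It is an ideal (core_ideal).  For a anisotropic, [E_b, E_a] is in the core
      as soon as b or a + b is anisotropic, so the only obstruction is a pair of
      isotropic roots b, a + b.  It is excluded as follows
      (isotropic_roots_not_anisotropic).  There 2(a|b) = - (a|a), so E_b, E_{-b}
      and t_b span a Heisenberg algebra acting on the string of a with nonzero
      central charge.  This makes a - b or a + 3b a root, of square 2(a|a) or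
      -2(a|a); pairing b with its coroot gives a half-integer, against the
      integrality that sl_2-theory and EA2 impose (coroot_integral). *)

(** * Ideals and generated subalgebras *)

Local Open Scope ring_scope.

Section LieAlgebras.
Set Implicit Arguments.
Unset Strict Implicit.
Import GRing.Theory.
Local Open Scope classical_set_scope.

Variables (k : fieldType) (E : lieAlgType k).
Implicit Types (x y z : E) (I : set E).

Definition lie_ideal I : Prop :=
  [/\ I 0, forall (c : k) x y, I x -> I y -> I (c *: x + y)
    & forall x y, I y -> I [lie x, y]].

Lemma lieC x y : [lie x, y] = - [lie y, x].
Proof.
apply/eqP; rewrite -addr_eq0; apply/eqP; have := lie_bracketxx (x + y).
by rewrite linearDl !linearDr /= !lie_bracketxx add0r addr0.
Qed.

Lemma lieA x y z : [lie x, [lie y, z]] = [lie [lie x, y], z] + [lie y, [lie x, z]].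
Proof.
have /eqP := lie_jacobi x y z; rewrite -addrA addr_eq0 => /eqP ->.
by rewrite opprD addrC -lieC; congr (_ + _); rewrite (lieC z x) linearNr opprK.
Qed.

Lemma lie_ideal_scaler I (c : k) x : lie_ideal I -> c != 0 -> I (c *: x) -> I x.
Proof.
case=> I0 Ilin _ c0 /(Ilin c^-1 _ _)/(_ I0).
by rewrite addr0 scalerA mulVf // scale1r.
Qed.

Lemma subalgebra_generated (S : set E) : lie_subalgebra (generated_subalgebra S).
Proof.
split=> [A [[A0 _ _] _] //|c x y Sx Sy A AS|x y Sx Sy A AS].
  by have [[_ Alin _] _] := AS; apply: Alin; [exact: Sx|exact: Sy].
by have [[_ _ Abr] _] := AS; apply: Abr; [exact: Sx|exact: Sy].
Qed.

Lemma subalgebra_centralizer (S : set E) : lie_subalgebra (centralizer S).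
Proof.
split=> [a _|c x y xC yC a Sa|x y xC yC a Sa]; first exact: linear0l.
  by rewrite linearDl linearZl_LR /= xC // yC // scaler0 addr0.
have := lieA x y a; rewrite (xC a) // (yC a) // !linear0r addr0.
exact: esym.
Qed.

Lemma subalgebra_ideal I : lie_ideal I -> lie_subalgebra I.
Proof. by case=> I0 Ilin Ibr; split=> // x y _; exact: Ibr. Qed.

(** The elements of the generated subalgebra that ad E carries back into it form
    a subalgebra, by the Jacobi identity, so generators suffice. *)
Lemma generated_subalgebra_ideal (S : set E) :
  (forall x y, S y -> generated_subalgebra S [lie x, y]) ->
  lie_ideal (generated_subalgebra S).
Proof.
move=> brS; have [G0 Glin Gbr] := subalgebra_generated S.
split=> //; suff: generated_subalgebra S `<=`
    [set y | generated_subalgebra S y /\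
             forall x, generated_subalgebra S [lie x, y]].
  by move=> sub x y /sub[_]; exact.
apply: smallest_sub => [|y Sy]; last first.
  by split=> [|x]; [exact: sub_gen_smallest|exact: brS].
split=> [|c y z [Gy yE] [Gz zE]|y z [Gy yE] [Gz zE]].
- by split=> // x; rewrite linear0r.
- split; first exact: Glin.
  by move=> x; rewrite linearDr linearZr_LR; exact: Glin.
- split; first exact: Gbr.
  by move=> x; rewrite lieA -[X in X + _]scale1r; apply: Glin; apply: Gbr.
Qed.

End LieAlgebras.

(** * Root spaces and the form *)

Section ToralPair.
Set Implicit Arguments.
Unset Strict Implicit.
Import GRing.Theory.
Local Open Scope classical_set_scope.

Variables (k : fieldType) (E : lieAlgType k).
Variables (H : submodClosed E) (f : {biscalar E}).
Hypotheses (symf : Defs.symmetric_form f) (ndf : nondegenerate_form f).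
Hypotheses (invf : invariant_form f) (ea1 : EA1 H).

Local Notation Hdual := (dual (submodule H)).
Implicit Types (a b c : Hdual) (s : seq Hdual) (h : submodule H) (x y v : E).

Local Notation t a := (val (dual_vec f a)).

(** The sum of two elements of the dual carries a type whose head is the carrier
    of an algebraic structure, from which the coercion to functions cannot be
    found: dual_fun has to be written out. *)
Lemma dual_addE a b h : dual_fun (a + b) h = a h + b h. Proof. by []. Qed.
Lemma dual_oppE a h : dual_fun (- a) h = - a h. Proof. by []. Qed.
Lemma dual_zeroE h : dual_fun (0 : Hdual) h = 0. Proof. by []. Qed.

Lemma dual_neq a b : a != b -> exists h, a h != b h.
Proof.
move=> /eqP ab; apply: contrapT => nab; apply: ab; apply: val_inj.
apply: funext => h; apply/eqP; apply: contra_notT nab => abh.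
by exists h.
Qed.

Lemma root_space_scale a (c : k) x : root_space a x -> root_space a (c *: x).
Proof. by move=> ax h; rewrite linearZr_LR /= ax !scalerA mulrC. Qed.

Lemma root_space_lie a b x y : root_space a x -> root_space b y ->
  root_space (a + b) [lie x, y].
Proof.
move=> ax byy h; rewrite lieA ax byy linearZr_LR linearZl_LR /= -scalerDl.
by rewrite dual_addE.
Qed.

Lemma root_space_iter a b x y n : root_space a x -> root_space b y ->
  root_space (a *+ n + b) (iter n (fun e => [lie x, e]) y).
Proof.
move=> ax byy; elim: n => [|n IHn]; first by rewrite mulr0n add0r.
by rewrite iterS mulrS -addrA; exact: root_space_lie.
Qed.

Lemma root_space0P x : root_space (0 : Hdual) x -> exists h, x = val h.
Proof.
have [_ _ _ _ E0] := ea1; rewrite E0 => xH.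
by exists (Sub x xH); rewrite SubK.
Qed.

Lemma root_decomposition x : exists (s : seq Hdual) (v : Hdual -> E),
  [/\ uniq s, forall a, root_space a (v a) & x = \sum_(a <- s) v a].
Proof. by have [_ _ _ [dec _] _] := ea1; exact: dec. Qed.

Lemma dual_formE a b : dual_form f a b = b (dual_vec f a).
Proof. by rewrite /dual_form symf dual_vecP. Qed.

Lemma dual_formC a b : dual_form f a b = dual_form f b a.
Proof. exact: symf. Qed.

Lemma dual_formDr a b c : dual_form f a (b + c) = dual_form f a b + dual_form f a c.
Proof. by rewrite !dual_formE dual_addE. Qed.

Lemma dual_formNr a b : dual_form f a (- b) = - dual_form f a b.
Proof. by rewrite !dual_formE dual_oppE. Qed.

Lemma dual_formDl a b c : dual_form f (a + b) c = dual_form f a c + dual_form f b c.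
Proof. by rewrite dual_formC dual_formDr !(dual_formC c). Qed.

Lemma dual_formNl a b : dual_form f (- a) b = - dual_form f a b.
Proof. by rewrite dual_formC dual_formNr dual_formC. Qed.

Lemma dual_formMnr a b n : dual_form f a (b *+ n) = dual_form f a b *+ n.
Proof.
elim: n => [|n IHn]; first by rewrite !mulr0n dual_formE dual_zeroE.
by rewrite !mulrS dual_formDr IHn.
Qed.

Lemma dual_formMnl a b n : dual_form f (a *+ n) b = dual_form f a b *+ n.
Proof. by rewrite dual_formC dual_formMnr dual_formC. Qed.

Lemma lie_dual_vec a b x : root_space b x -> [lie t a, x] = dual_form f a b *: x.
Proof. by move=> ->; rewrite dual_formE. Qed.

(** For h in the torus, invariance moves ad h across the form, whence
    (a + b)(h) (x|y) = 0. *)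
Lemma form_root_space_orthogonal a b x y :
  root_space a x -> root_space b y -> b != - a -> f x y = 0.
Proof.
move=> ax byy; rewrite -addr_eq0 => /dual_neq[h]; rewrite dual_addE dual_zeroE.
move=> abh; apply/eqP; rewrite -(mulrI_eq0 _ (mulfI abh)) mulrDl addr_eq0.
rewrite -(linearZr_LR f) -(linearZl_LR f) /= -ax -byy.
by rewrite -invf (lieC x) linearNl.
Qed.

(** Nondegeneracy of the form on all of E restricts to a perfect pairing of E_a
    with E_{-a}, because E_a is orthogonal to the other root spaces. *)
Lemma root_space_dual_pair a x : root_space a x -> x != 0 ->
  exists2 y, root_space (- a) y & f x y = 1.
Proof.
move=> ax x0; have [y fxy] : exists y, f x y != 0.
  apply: contrapT => nxy; move: x0; rewrite (ndf (x := x)) ?eqxx // => y.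
  by apply/eqP; apply: contra_notT nxy => ?; exists y.
have [s [v [_ vP yE]]] := root_decomposition y.
suff xv0 : f x (v (- a)) != 0.
  exists ((f x (v (- a)))^-1 *: v (- a)); first exact: root_space_scale.
  by rewrite linearZr_LR /= mulVf.
apply: contraNN fxy => /eqP xv0; rewrite yE linear_sumr big1 // => b _.
have [-> //|ba] := eqVneq b (- a).
exact: (form_root_space_orthogonal ax (vP b)).
Qed.

(** [x, y] has weight 0, so it lies in the torus, where it is determined by its
    pairings ([x, y]|h) = (x|[y, h]) = a(h) (x|y). *)
Lemma lie_opposite a x y : root_space a x -> root_space (- a) y ->
  [lie x, y] = f x y *: t a.
Proof.
move=> ax ay; have := root_space_lie ax ay; rewrite subrr => /root_space0P[h hE].
rewrite hE -linearZ; congr (val _); apply/eqP; rewrite -subr_eq0; apply/eqP.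
apply: (form_nondegenerate_on_torus ndf invf ea1) => h'.
have -> : val (h - f x y *: dual_vec f a) = val h - f x y *: t a by [].
rewrite linearBl linearZl_LR /= -hE dual_vecP // invf.
by rewrite lieC ay linearNr linearZr_LR /= dual_oppE mulNr opprK mulrC subrr.
Qed.

Lemma opposite_pair a : Defs.roots a ->
  exists x y, [/\ root_space a x, root_space (- a) y & [lie x, y] = t a].
Proof.
case=> x ax x0; have [y ay fxy] := root_space_dual_pair ax x0.
by exists x, y; split=> //; rewrite (lie_opposite ax ay) fxy scale1r.
Qed.

Lemma roots_opp a : Defs.roots a -> Defs.roots (- a).
Proof.
case=> x ax x0; have [y ay fxy] := root_space_dual_pair ax x0; exists y => //.
by apply: contra_eq_neq fxy => ->; rewrite linear0r eq_sym oner_eq0.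
Qed.

(** The lowering computation on a highest weight vector v of weight b: each
    passage of ad x through ad y contributes (a|b - i a), for i = 0, ..., n.  For a
    anisotropic this is sl_2-theory up to rescaling; for a isotropic the second
    term disappears and the triple x, y, t_a is a Heisenberg algebra. *)
Lemma lie_iter_opposite a b x y v n :
  root_space (- a) y -> [lie x, y] = t a -> root_space b v -> [lie x, v] = 0 ->
  [lie x, iter n.+1 (fun e => [lie y, e]) v] =
    (dual_form f a b *+ n.+1 - dual_form f a a *+ 'C(n.+1, 2))
      *: iter n (fun e => [lie y, e]) v.
Proof.
move=> ay xy bv xv.
elim: n => [|n IHn].
  rewrite iterS lieA xy xv linear0r addr0 (lie_dual_vec _ bv) mulr1n.
  by rewrite mulr0n subr0.
rewrite iterS lieA xy (lie_dual_vec _ (root_space_iter n.+1 ay bv)) IHn.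
have -> : 'C(n.+2, 2) = ('C(n.+1, 2) + n.+1)%N by rewrite binS bin1.
move: 'C(n.+1, 2) => m; rewrite linearZr_LR /= -iterS -scalerDl; congr (_ *: _).
by rewrite dual_formDr dual_formMnr dual_formNr; ring.
Qed.

(** * The dichotomy for ideals *)

(** Applying ad h - b(h) for an h that separates a from b removes the term of
    weight b and only rescales the others, the term of weight a by a nonzero
    factor; induction on s removes everything except x. *)
Lemma lie_ideal_component I a s x (v : Hdual -> E) : lie_ideal I ->
  root_space a x -> (forall b, root_space b (v b)) -> a \notin s ->
  I (x + \sum_(b <- s) v b) -> I x.
Proof.
move=> Iid; have [I0 Ilin Ibr] := Iid.
elim: s x v => [|b s IHs] x v ax vP; first by rewrite big_nil addr0.
rewrite inE negb_or => /andP[ab sa] Isum.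
have [h abh] := dual_neq ab; apply: (@lie_ideal_scaler _ _ I (a h - b h)) => //.
  by rewrite subr_eq0.
apply: (IHs _ (fun c => (c h - b h) *: v c)) => //; first exact: root_space_scale.
  by move=> c; exact: root_space_scale.
have := Ilin (- b h) _ _ Isum (Ibr (val h) _ Isum).
rewrite big_cons !linearDr linear_sumr /= ax vP !scalerDr scaler_sumr; congr I.
rewrite addrACA -scalerDl [- _ + _]addrC; congr (_ + _).
rewrite addrACA -scalerDl addNr scale0r add0r -big_split /=.
by apply: eq_bigr => c _; rewrite vP -scalerDl addrC.
Qed.

Lemma lie_ideal_graded I s (v : Hdual -> E) : lie_ideal I -> uniq s ->
  (forall b, root_space b (v b)) -> I (\sum_(b <- s) v b) ->
  forall a, a \in s -> I (v a).
Proof.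
move=> Iid us vP Isum a sa; rewrite (bigD1_seq a) //= -big_filter in Isum.
by apply: (lie_ideal_component Iid (vP a) vP _ Isum); rewrite mem_filter eqxx.
Qed.

Lemma lie_ideal_dual_vec I a x : lie_ideal I -> root_space a x -> x != 0 ->
  I x -> I (t a).
Proof.
move=> [I0 Ilin Ibr] ax x0 Ix; have [y ay fxy] := root_space_dual_pair ax x0.
have <- : -1 *: [lie y, x] + 0 = t a.
  by rewrite addr0 scaleN1r -lieC (lie_opposite ax ay) fxy scale1r.
by apply: Ilin => //; exact: Ibr.
Qed.

Lemma lie_ideal_root_space I a b : lie_ideal I -> I (t a) ->
  dual_form f a b != 0 -> root_space b `<=` I.
Proof.
move=> Iid Ita ab y byy; have [I0 Ilin Ibr] := Iid.
apply: (lie_ideal_scaler Iid ab); rewrite -(lie_dual_vec _ byy) lieC -scaleN1r.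
by rewrite -[X in I X]addr0; apply: Ilin => //; exact: Ibr.
Qed.

(** If I does not contain the core, EA3 for the partition of the anisotropic roots
    c according to whether I contains E_c yields non-orthogonal c and d on the two
    sides; but then t_c is in I and forces E_d into I. *)
Lemma core_sub_ideal I a x : EA3 H f -> lie_ideal I ->
  anisotropic_roots f a -> root_space a x -> x != 0 -> I x -> core H f `<=` I.
Proof.
move=> ea3 Iid aan ax x0 Ix; apply: smallest_sub; first exact: subalgebra_ideal.
move=> y [b ban]; apply: contraPP => nIy byy.
have Idual c : anisotropic_roots f c -> root_space c `<=` I -> I (t c).
  move=> [[z cz z0] _] cI; exact: (lie_ideal_dual_vec Iid cz z0 (cI _ cz)).
have aI : root_space a `<=` I.
  apply: (lie_ideal_root_space Iid (lie_ideal_dual_vec Iid ax x0 Ix)).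
  by apply/eqP; case: aan.
pose P c := root_space c `<=` I.
have [|||c [d [[can cI] [dan dnI] cd]]] := ea3 (anisotropic_roots f `&` P)
    (anisotropic_roots f `\` P).
- by rewrite setUIDK.
- by exists a.
- by exists b; split=> // bI; apply: nIy; exact: bI.
apply: dnI; apply: (lie_ideal_root_space Iid (Idual c can cI)); exact/eqP.
Qed.

(** It suffices that each component v b of an element of I commutes with E_a for a
    anisotropic.  The bracket lies in I and has weight a + b, which is again
    anisotropic: b is orthogonal to a, for otherwise t_b would force E_a into I,
    and b is isotropic. *)
Lemma ideal_sub_centralizer I : lie_ideal I ->
  (forall a x, anisotropic_roots f a -> root_space a x -> I x -> x = 0) ->
  I `<=` centralizer (core H f).
Proof.
move=> Iid Ian z Iz w.
have [s [v [us vP zE]]] := root_decomposition z; rewrite zE in Iz.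
have Iv := lie_ideal_graded Iid us vP Iz.
suff: core H f `<=` centralizer [set v b | b in [set` s]].
  move=> sub /sub wC; rewrite lieC zE linear_sumr big_seq big1 ?oppr0 // => b sb.
  by apply: wC; exists b.
apply: smallest_sub; first exact: subalgebra_centralizer.
move=> {w}y [a aan ay] _ [b sb <-]; have [_ aa] := aan.
have [-> |vb0] := eqVneq (v b) 0; first by rewrite linear0r.
have ba0 : dual_form f b a = 0.
  apply: contrapT => /eqP ba.
  have ay' := lie_ideal_root_space Iid (lie_ideal_dual_vec Iid (vP b) vb0 (Iv b sb)) ba.
  have [[x ax x0] _] := aan; case/eqP: x0; apply: (Ian a) => //; exact: ay'.
have bb0 : dual_form f b b = 0.
  apply: contrapT => bb; case/eqP: (vb0); apply: (Ian b) (Iv b sb) => //.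
  by split=> //; exists (v b).
apply: contrapT => /eqP yv0; case/eqP: (yv0); apply: (Ian (a + b)).
- split; first by exists [lie y, v b] => //; exact: root_space_lie.
  by rewrite dual_formDl !dual_formDr ba0 dual_formC ba0 bb0 !addr0.
- exact: root_space_lie.
- by have [_ _ Ibr] := Iid; apply: Ibr; exact: Iv.
Qed.

(** Without anisotropic roots the core would be 0 and its centralizer E, so EA4
    would make E, and with it the torus, vanish. *)
Lemma anisotropic_root_exists : EA4 H f -> exists a, anisotropic_roots f a.
Proof.
move=> ea4; apply: contrapT => nan; have [[h hH h0] _ _ _ _] := ea1.
have core0 : core H f `<=` [set 0].
  apply: smallest_sub => [|x [a aan _]]; last by case: nan; exists a.
  split=> // [c x y -> ->|x y -> ->]; first by rewrite scaler0 addr0.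
  by rewrite linear0l.
case/eqP: h0; apply: (core0); apply: ea4 => x /core0 ->; exact: linear0r.
Qed.

(** * Integrality and the core as an ideal *)

Section CharacteristicZero.
Hypotheses (char0 : [pchar k] =i pred0) (ea2 : EA2 H f).

Lemma natr_inj_char0 m n : m%:R = n%:R :> k -> m = n.
Proof.
wlog mn : m n / (m <= n)%N => [wl|/eqP].
  by have [/wl//|/ltnW/wl wl'] := leqP m n => /esym/wl'/esym.
rewrite eq_sym -subr_eq0 -natrB // ((pcharf0P k).1 char0); lia.
Qed.

(** Raise a vector of weight b by E_a as far as possible, in p steps, to a highest
    weight vector w, and let n be the last number of lowering steps that does not
    kill w; both exist by EA2.  The lowering formula at step n + 1 reads
    2(a|b + p a) = n (a|a), so the integer 2(a|b) / (a|a) is n - 2p. *)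
Lemma coroot_integral a b : anisotropic_roots f a -> Defs.roots b ->
  exists p q : nat, dual_form f a b *+ 2 = (p%:R - q%:R) * dual_form f a a.
Proof.
move=> aan [v bv v0]; have [ra aa] := aan.
have [x [y [ax ay xy]]] := opposite_pair ra.
have nilp c z u : anisotropic_roots f c -> root_space c z -> u != 0 ->
    exists n, iter n (fun e => [lie z, e]) u != 0 /\
              iter n.+1 (fun e => [lie z, e]) u = 0.
  move=> can cz u0; have ex : exists n, iter n (fun e => [lie z, e]) u == 0.
    by have [n nu] := ea2 can cz u; exists n; exact/eqP.
  case: (ex_minnP ex) => -[|n] /eqP n0 nmin; first by rewrite /= in n0; rewrite n0 eqxx in u0.
  by exists n; split=> //; apply/negP => /nmin; rewrite ltnn.
have [p [w0 xw]] := nilp a x v aan ax v0.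
set w := iter p _ v in w0 xw.
have bw : root_space (a *+ p + b) w := root_space_iter p ax bv.
have naan : anisotropic_roots f (- a).
  by split; [exact: roots_opp|rewrite dual_formNl dual_formNr opprK].
have [n [yw0 yw]] := nilp (- a) y w naan ay w0.
have := lie_iter_opposite n ay xy bw xw.
rewrite yw linear0r => /esym/eqP; rewrite scaler_eq0 (negPf yw0) orbF.
rewrite dual_formDr dual_formMnr => /eqP eq0.
exists n, (p * 2)%N.
have n0 : n.+1%:R != 0 :> k by apply/eqP => /(@natr_inj_char0 n.+1 0).
apply: (mulfI n0); apply/eqP; rewrite -subr_eq0; apply/eqP.
have bin2n : ('C(n.+1, 2) * 2 = n.+1 * n)%N by rewrite mulnC -mul_bin_diag bin1.
transitivity (0 *+ 2 : k); last by rewrite mul0rn.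
rewrite -eq0 mulrnBl -!mulrnA bin2n.
by ring.
Qed.

(** A weak form of the fact that isotropic roots are orthogonal to all roots: the
    value 2(a|b) = - (a|a) forced by the hypotheses is the only one at which, for b
    isotropic, [E_b, E_a] could escape from the core, and it makes two explicit roots of the
    b-string of a violate integrality. *)
Lemma isotropic_roots_not_anisotropic a b :
  isotropic_roots f b -> isotropic_roots f (a + b) -> ~ anisotropic_roots f a.
Proof.
move=> [rb bb] [_ abab] aan; have [[v av v0] aa] := aan.
have ab : dual_form f a b *+ 2 = - dual_form f a a.
  move: abab; rewrite dual_formDl !dual_formDr bb addr0 (dual_formC b a) => /eqP.
  by rewrite -addrA -mulr2n addrC addr_eq0 => /eqP.
have AE : dual_form f a a = - (dual_form f a b *+ 2) by rewrite ab opprK.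
have A0 : dual_form f a a != 0 by exact/eqP.
(* For such a c, 2(c|b) / (c|c) = -1/2 or 1/2. *)
have half_integral c : Defs.roots c -> dual_form f c b *+ 2 = - dual_form f a a ->
    dual_form f c c = dual_form f a a *+ 2 \/
    dual_form f c c = - (dual_form f a a *+ 2) -> False.
  move=> rc cb cc; have can : anisotropic_roots f c.
    split=> // cc0; case: cc; rewrite cc0 => /esym/eqP; rewrite ?oppr_eq0;
      by rewrite -mulr_natl mulf_eq0 (negPf A0) orbF => /eqP/(@natr_inj_char0 2 0).
  have [p [q]] := coroot_integral can rb; rewrite cb; case: cc => -> E2.
    have : (2 * p + 1)%:R = (2 * q)%:R :> k; last by move/natr_inj_char0; lia.
    apply: (mulIf A0); rewrite natrD !natrM; apply/eqP; rewrite -subr_eq0.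
    rewrite -[X in _ == X](subrr (- dual_form f a a)) {1}E2; apply/eqP; ring.
  have : (2 * q + 1)%:R = (2 * p)%:R :> k; last by move/natr_inj_char0; lia.
  apply: (mulIf A0); rewrite natrD !natrM; apply/eqP; rewrite -subr_eq0.
  rewrite -[X in _ == X](subrr (- dual_form f a a)) {1}E2; apply/eqP; ring.
(* y in E_{-b} raises and x in E_b lowers for the root - b, so that in the case
   [y, v] = 0 the lowering formula shows that no power of ad x kills v. *)
have [y [x [by_ bx yx]]] := opposite_pair (roots_opp rb); rewrite opprK in bx.
have [yv|yv] := eqVneq [lie y, v] 0; last first.
  apply: (half_integral (- b + a)).
  - by exists [lie y, v] => //; exact: root_space_lie.
  - by rewrite dual_formDl dual_formNl bb oppr0 add0r.
  - left; rewrite dual_formDl !dual_formDr !dual_formNl !dual_formNr bb.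
    rewrite (dual_formC b a) AE; ring.
have xv n : iter n (fun e => [lie x, e]) v != 0.
  elim: n => [//|n IHn].
  apply/eqP => x0; have bb' : dual_form f (- b) (- b) = 0.
    by rewrite dual_formNl dual_formNr bb !oppr0.
  have := @lie_iter_opposite (- b) a y x v n; rewrite opprK => /(_ bx yx av yv).
  rewrite x0 linear0r bb' mul0rn subr0 => /esym/eqP.
  rewrite scaler_eq0 (negPf IHn) orbF -mulr_natl mulf_eq0 => /orP[].
    by move=> /eqP/(@natr_inj_char0 n.+1 0).
  rewrite dual_formNl oppr_eq0 dual_formC => /eqP ab0.
  by move/eqP: ab; rewrite ab0 mul0rn eq_sym oppr_eq0 (negPf A0).
apply: (half_integral (b *+ 3 + a)).
- exists (iter 3 (fun e => [lie x, e]) v) => //; exact: root_space_iter.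
- by rewrite dual_formDl dual_formMnl bb mul0rn add0r.
- right; rewrite (_ : b *+ 3 = b + b + b); last by rewrite !mulrS addr0 addrA.
  rewrite !dual_formDl !dual_formDr bb.
  rewrite (dual_formC b a) AE; ring.
Qed.

(** A nonzero bracket of E_b with E_a, a anisotropic, makes b and a + b roots that
    are not both isotropic; if b is anisotropic both factors are generators, and
    if a + b is, the bracket itself is one. *)
Lemma core_ideal : lie_ideal (core H f).
Proof.
apply: generated_subalgebra_ideal => e x [a aan ax].
have [C0 Clin Cbr] :
    lie_subalgebra (core H f) by exact: subalgebra_generated.
have Can b y : anisotropic_roots f b -> root_space b y -> core H f y.
  by move=> ban byy; apply: sub_gen_smallest; exists b.
have [s [v [_ vP ->]]] := root_decomposition e; rewrite linear_sumlz.
rewrite -/(core H f); elim: s => [|b s IHs]; first by rewrite big_nil.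
rewrite big_cons -[X in X + _]scale1r; apply: Clin => //.
have [-> |vx0] := eqVneq [lie v b, x] 0; first exact: C0.
have rb : Defs.roots b.
  by exists (v b) => //; apply: contraNneq vx0 => ->; rewrite linear0l.
have rab : Defs.roots (a + b).
  by exists [lie v b, x] => //; rewrite addrC; exact: root_space_lie.
have [bb|bb] := eqVneq (dual_form f b b) 0; last first.
  by apply: Cbr; [apply: Can (vP b); split=> //; exact/eqP|exact: Can ax].
have [abab|abab] := eqVneq (dual_form f (a + b) (a + b)) 0.
  by case: (@isotropic_roots_not_anisotropic a b).
apply: (Can (a + b)); first by split=> //; exact/eqP.
by rewrite addrC; exact: root_space_lie.
Qed.

End CharacteristicZero.

(** * Comparison of two cores *)

(** If I avoids all anisotropic root spaces, it centralizes the core and, by EA4,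
    is contained in it; so it commutes with itself. *)
Lemma core_sub_nonabelian_ideal I : EA3 H f -> lie_ideal I ->
  (exists x y, [/\ I x, I y & [lie x, y] != 0]) -> EA4 H f ->
  core H f `<=` I.
Proof.
move=> ea3 Iid [x [y [Ix Iy xy0]]] ea4.
apply: contrapT => nsub; case/eqP: xy0.
suff IC : I `<=` centralizer (core H f) by apply: (IC) => //; apply: ea4; exact: IC.
apply: ideal_sub_centralizer => // a z aan az Iz; apply/eqP.
by apply: contra_notT nsub => z0; exact: (core_sub_ideal ea3 Iid aan az).
Qed.

(** For a anisotropic, x in E_a and its dual y in E_{-a} are in the core, and
    [[x, y], x] = [t_a, x] = (a|a) x. *)
Lemma core_nonabelian : EA4 H f ->
  exists x y, [/\ core H f x, core H f y & [lie x, y] != 0].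
Proof.
move=> /anisotropic_root_exists[a aan]; have [ra aa] := aan.
have [[x ax x0] _] := aan; have [y ay fxy] := root_space_dual_pair ax x0.
have [_ Clin Cbr] : lie_subalgebra (core H f) by exact: subalgebra_generated.
have Cx : core H f x by apply: sub_gen_smallest; exists a.
have Cy : core H f y.
  apply: sub_gen_smallest; exists (- a) => //; split; first exact: roots_opp.
  by rewrite dual_formNl dual_formNr opprK.
exists [lie x, y], x; split=> //; first exact: Cbr.
rewrite (lie_opposite ax ay) fxy scale1r (lie_dual_vec _ ax) scaler_eq0 negb_or x0.
by rewrite andbT; exact/eqP.
Qed.

End ToralPair.

Lemma core_sub_core (k : fieldType) (char0 : [pchar k] =i pred0)
    (E : lieAlgType k)
    (H : submodClosed E) (f : {biscalar E}) (EALA : is_EALA H f)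
    (H' : submodClosed E) (f' : {biscalar E}) (EALA' : is_EALA H' f') :
  (core H f `<=` core H' f')%classic.
Proof.
have [[symf ndf invf] [ea1 _ ea3 ea4 _]] := EALA.
have [[symf' ndf' invf'] [ea1' ea2' _ ea4' _]] := EALA'.
apply: core_sub_nonabelian_ideal => //; first exact: core_ideal.
exact: core_nonabelian.
Qed.

Theorem corollary3p2 (k : fieldType) (char0 : [pchar k] =i pred0)
    (E : lieAlgType k)
    (H : submodClosed E) (f : {biscalar E}) (EALA : is_EALA H f)
    (H' : submodClosed E) (f' : {biscalar E}) (EALA' : is_EALA H' f') :
  core H f = core H' f'.
Proof. by apply/seteqP; split; exact: core_sub_core. Qed.
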